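(* Let $p$ be a prime number and let $\alpha\in\mathbb{Q}$. Then the sequence $\{\alpha_n\}$ generated from $\alpha_0=\alpha$ by the algorithm described in the context is finite (i.e. the algorithm halts).
   Context: Let $p$ be a prime and $K$ a field with field embeddings $\sigma_\infty:K\to\mathbb{R}$ and $\sigma_p:K\to\mathbb{Q}_p$ (so $\mathbb{Q}\subset K$). For $\alpha\in K$ write $\alpha_\infty=\sigma_\infty(\alpha)$ and $\alpha_{\langle p\rangle}=\sigma_p(\alpha)$. Every $u\in\mathbb{Q}_p$ is uniquely $u=\sum_{n\in\mathbb{Z}}c_np^n$ with $c_n\in\{0,\dots,p-1\}$ and $c_n=0$ for $n<v_p(u)$; put $\lfloor u\rfloor_p=\sum_{n\le 0}c_np^n\in\mathbb{Z}[1/p]$. For $\alpha\in K$ let $b^{(0)}(\alpha)=mp+\lfloor\alpha_{\langle p\rangle}\rfloor_p$, where $m$ is the smallest among the integers $i$ minimizing $|\alpha_\infty-ip-\lfloor\alpha_{\langle p\rangle}\rfloor_p|$; let $b^{(1)}(\alpha)=m'+\lfloor\alpha_{\langle p\rangle}\rfloor_p$, where $m'$ is the smallest among the integers $i$ minimizing $|\alpha_\infty-i-\lfloor\alpha_{\langle p\rangle}\rfloor_p|$. For $\epsilon\in\{0,1\}$ let $F_{p,\epsilon}(\alpha)=\frac{1}{\alpha-b^{(\epsilon)}(\alpha)}$, undefined if $\alpha=b^{(\epsilon)}(\alpha)$. Algorithm: $\alpha_0=\alpha$; $\alpha_{n+1}=F_{p,0}(\alpha_n)$ if $n$ is even and $\alpha_{n+1}=F_{p,1}(\alpha_n)$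 if $n$ is odd. The algorithm halts (and $\alpha_{n+1},\alpha_{n+2},\dots$ are not defined) if the required value $F_{p,0}(\alpha_n)$ or $F_{p,1}(\alpha_n)$ is undefined. *)

(* Defs.v *)
From HB Require Import structures.
From mathcomp Require Import all_boot all_order all_algebra.
From mathcomp Require Import boolp classical_sets cardinality fsbigop reals.
From mathcomp Require Import zify ring lra.

Set Implicit Arguments.
Unset Strict Implicit.
Unset Printing Implicit Defensive.

Import Order.TTheory GRing.Theory Num.Theory.
Local Open Scope classical_set_scope.
Local Open Scope ring_scope.

(* The ring Z_p is the inverse limit of the Z / p^n: an element is the family
   of its reduced residues mod p^n, each one the reduction of the next.  The
   type depends on a proof that p is prime so that it can be declared an
   integral domain. *)

Definition coherent (p : nat) (f : nat -> int) :=
  forall n, f n = (f n.+1 %% (p ^ n)%N)%Z.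

Record padic_int (p : nat) (p_pr : prime p) := PadicInt {
  residue : nat -> int;
  _ : `[< coherent p residue >] }.

Section PadicInt.
Variables (p : nat) (p_pr : prime p).
Local Notation Zp := (padic_int p_pr).

HB.instance Definition _ := [isSub for @residue p p_pr].
HB.instance Definition _ := [Choice of padic_int p_pr by <:].

Lemma pX_neq0 n : (p ^ n)%N%:Z != 0.
Proof. by rewrite eqz_nat -lt0n expn_gt0 prime_gt0. Qed.

Lemma residueS (x : Zp) n : residue x n = (residue x n.+1 %% (p ^ n)%N)%Z.
Proof. by case: x => f /= /asboolP. Qed.

Lemma residue_mod (x : Zp) n : (residue x n %% (p ^ n)%N)%Z = residue x n.
Proof. by rewrite residueS modz_mod. Qed.

Lemma residue_ge0 (x : Zp) n : 0 <= residue x n.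
Proof. by rewrite residueS modz_ge0 // pX_neq0. Qed.

Lemma padic_int_eq (x y : Zp) : residue x =1 residue y -> x = y.
Proof. by move=> xy; apply/val_inj/funext. Qed.

Lemma modz_pXl (a : int) m n : (m <= n)%N ->
  ((a %% (p ^ n)%N)%Z %% (p ^ m)%N)%Z = (a %% (p ^ m)%N)%Z.
Proof.
move=> mn; apply/eqP; rewrite eqz_mod_dvd.
have -> : (a %% (p ^ n)%N)%Z - a = - ((a %/ (p ^ n)%N)%Z * (p ^ n)%N).
  by rewrite {2}(divz_eq a (p ^ n)%N); ring.
by rewrite rpredN dvdz_mull // /dvdz; exact: dvdn_exp2l.
Qed.

Lemma residue_le (x : Zp) m n : (m <= n)%N ->
  residue x m = (residue x n %% (p ^ m)%N)%Z.
Proof.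
elim: n => [|n IHn]; first by rewrite leqn0 => /eqP ->; rewrite residue_mod.
rewrite leq_eqVlt => /orP[/eqP ->|]; first by rewrite residue_mod.
by rewrite ltnS => mn; rewrite (IHn mn) (residueS x n) modz_pXl.
Qed.

Fact reduce_subproof (g : nat -> int) :
  (forall n, g n = g n.+1 %[mod (p ^ n)%N])%Z ->
  `[< coherent p (fun n => (g n %% (p ^ n)%N)%Z) >].
Proof. by move=> gP; apply/asboolP => n; rewrite modz_pXl. Qed.

Definition reduce g gP : Zp := PadicInt p_pr (@reduce_subproof g gP).

Fact const_subproof (a : int) n : (a = a %[mod (p ^ n)%N])%Z.
Proof. by []. Qed.
Fact add_subproof (x y : Zp) n :
  (residue x n + residue y n = residue x n.+1 + residue y n.+1
    %[mod (p ^ n)%N])%Z.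
Proof. by rewrite (residueS x n) (residueS y n) modzDm. Qed.
Fact opp_subproof (x : Zp) n :
  (- residue x n = - residue x n.+1 %[mod (p ^ n)%N])%Z.
Proof. by rewrite (residueS x n) modzNm. Qed.
Fact mul_subproof (x y : Zp) n :
  (residue x n * residue y n = residue x n.+1 * residue y n.+1
    %[mod (p ^ n)%N])%Z.
Proof. by rewrite (residueS x n) (residueS y n) modzMm. Qed.

Definition padic_const a : Zp := reduce (const_subproof a).
Definition padic_add x y : Zp := reduce (add_subproof x y).
Definition padic_opp x : Zp := reduce (opp_subproof x).
Definition padic_mul x y : Zp := reduce (mul_subproof x y).

Fact padic_addA : associative padic_add.
Proof.
by move=> x y z; apply: padic_int_eq => n /=; rewrite modzDml modzDmr addrA.
Qed.
Fact padic_addC : commutative padic_add.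
Proof. by move=> x y; apply: padic_int_eq => n /=; rewrite addrC. Qed.
Fact padic_add0 : left_id (padic_const 0) padic_add.
Proof.
by move=> x; apply: padic_int_eq => n /=; rewrite modzDml add0r residue_mod.
Qed.
Fact padic_addN : left_inverse (padic_const 0) padic_opp padic_add.
Proof. by move=> x; apply: padic_int_eq => n /=; rewrite modzDml addNr. Qed.

HB.instance Definition _ := GRing.isZmodule.Build (padic_int p_pr)
  padic_addA padic_addC padic_add0 padic_addN.

Fact padic_mulA : associative padic_mul.
Proof.
by move=> x y z; apply: padic_int_eq => n /=; rewrite modzMml modzMmr mulrA.
Qed.
Fact padic_mulC : commutative padic_mul.
Proof. by move=> x y; apply: padic_int_eq => n /=; rewrite mulrC. Qed.
Fact padic_mul1 : left_id (padic_const 1) padic_mul.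
Proof.
by move=> x; apply: padic_int_eq => n /=; rewrite modzMml mul1r residue_mod.
Qed.
Fact padic_mulD : left_distributive padic_mul padic_add.
Proof.
move=> x y z; apply: padic_int_eq => n /=.
by rewrite modzMml modzDm mulrDl.
Qed.
Fact padic_1neq0 : padic_const 1 != 0.
Proof.
apply/eqP => /(congr1 (fun x : Zp => residue x 1)) /=.
by rewrite expn1 mod0z modz_small //= ltz_nat prime_gt1.
Qed.

HB.instance Definition _ := GRing.Zmodule_isComNzRing.Build (padic_int p_pr)
  padic_mulA padic_mulC padic_mul1 padic_mulD padic_1neq0.

Definition padic_unit : {pred Zp} := fun x => `[< exists y, y * x = 1 >].
Definition padic_inv (x : Zp) : Zp := xget x [set y | y * x = 1].

Fact padic_mulV : {in padic_unit, left_inverse 1 padic_inv *%R}.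
Proof. by move=> x /asboolP[y yx]; apply: (xgetI (P := [set y | y * x = 1]) x yx). Qed.
Fact padic_unitP x y : y * x = 1 -> padic_unit x.
Proof. by move=> yx; apply/asboolP; exists y. Qed.
Fact padic_invr_out : {in [predC padic_unit], padic_inv =1 id}.
Proof.
move=> x /negP nx; apply: xgetPN => y yx; apply: nx.
exact: padic_unitP yx.
Qed.

HB.instance Definition _ := GRing.ComNzRing_hasMulInverse.Build
  (padic_int p_pr) padic_mulV padic_unitP padic_invr_out.

Lemma residueM (x y : Zp) n :
  residue (x * y) n = (residue x n * residue y n %% (p ^ n)%N)%Z.
Proof. by []. Qed.

Lemma residueD (x y : Zp) n :
  residue (x + y) n = ((residue x n + residue y n) %% (p ^ n)%N)%Z.
Proof. by []. Qed.

Lemma residueN (x : Zp) n :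
  residue (- x) n = (- residue x n %% (p ^ n)%N)%Z.
Proof. by []. Qed.

Lemma residue0 n : residue (0 : Zp) n = 0.
Proof. by rewrite /= mod0z. Qed.

Lemma padic_neq0 (x : Zp) : x != 0 -> exists n, residue x n != 0.
Proof.
move=> /eqP x0; apply: contrapT => xP; apply: x0.
apply: padic_int_eq => n; rewrite residue0; apply/eqP/negPn/negP => xn.
by apply: xP; exists n.
Qed.

Fact padic_integral : GRing.integral_domain_axiom (padic_int p_pr).
Proof.
move=> x y xy0; apply/norP => -[/padic_neq0[k xk] /padic_neq0[l yl]].
have : residue (x * y) (k + l) = 0 by rewrite xy0 residue0.
rewrite residueM => /eqP.
have {xk}xk : ~~ ((p ^ k)%N %| residue x (k + l))%Z.
  by move: xk; rewrite (residue_le x (leq_addr l k)) => /eqP xk; apply/dvdz_mod0P.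
have {yl}yl : ~~ ((p ^ l)%N %| residue y (k + l))%Z.
  by move: yl; rewrite (residue_le y (leq_addl k l)) => /eqP yl; apply/dvdz_mod0P.
move/eqP/dvdz_mod0P; rewrite dvdzE abszM.
move: xk yl; rewrite !dvdzE; set a := absz (residue x _); set b := absz (residue y _).
rewrite !absz_nat => ka lb.
have a0 : (0 < a)%N by rewrite lt0n; apply: contraNneq ka => ->; rewrite dvdn0.
have b0 : (0 < b)%N by rewrite lt0n; apply: contraNneq lb => ->; rewrite dvdn0.
rewrite pfactor_dvdn ?muln_gt0 ?a0 // lognM //.
move: ka lb; rewrite !pfactor_dvdn //; lia.
Qed.

HB.instance Definition _ := GRing.ComUnitRing_isIntegral.Build
  (padic_int p_pr) padic_integral.

Lemma residue_nat k n : residue (k%:R : Zp) n = (k%:Z %% (p ^ n)%N)%Z.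
Proof.
elim: k => [|k IHk]; first by rewrite mulr0n residue0 mod0z.
rewrite -addn1 natrD residueD IHk modzDml PoszD.
have -> : residue (1%:R : Zp) n = (1 %% (p ^ n)%N)%Z by [].
by rewrite modzDmr.
Qed.

Lemma padic_dvdP (z : Zp) N :
  residue z N = 0 <-> exists w, z = p%:R ^+ N * w.
Proof.
have dvN n (a : Zp) : residue a N = 0 -> ((p ^ N)%N %| residue a (n + N))%Z.
  by move=> aN; apply/dvdz_mod0P; rewrite -(residue_le a (leq_addl n N)).
split=> [zN|[w ->]]; last first.
  rewrite -natrX residueM residue_nat modzMml.
  by apply/dvdz_mod0P; rewrite dvdz_mulr.
pose g n := (residue z (n + N) %/ (p ^ N)%N)%Z.
have gP n : (g n = g n.+1 %[mod (p ^ n)%N])%Z.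
  rewrite /g (residueS z (n + N)) addSn.
  move: (residue z _) => a; rewrite {2}(divz_eq a (p ^ (n + N))%N).
  move: (a %/ _)%Z (a %% _)%Z => q r.
  by rewrite expnD PoszM mulrA divzMDl ?pX_neq0 // modzMDl.
exists (reduce gP); apply: padic_int_eq => n.
rewrite -natrX residueM residue_nat modzMml /= modzMmr mulrC /g divzK ?dvN //.
by rewrite -(residue_le z (leq_addr N n)).
Qed.

Lemma padic_unitE (x : Zp) : residue x 1 != 0 -> exists y, y * x = 1.
Proof.
move=> x1.
have co n : coprimez (residue x n.+1) (p ^ n.+1)%N.
  rewrite /coprimez /gcdz eqz_nat -/(coprime _ _) absz_nat coprimeXr //.
  rewrite coprime_sym prime_coprime //; apply: contra x1 => px.
  rewrite (residue_le x (ltn0Sn n)) expn1; apply/eqP/dvdz_mod0P.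
  by rewrite dvdzE.
pose g n := (egcdz (residue x n) (p ^ n)%N).1.
have g1 n : (g n * residue x n = 1 %[mod (p ^ n)%N])%Z.
  case: n => [|n]; first by rewrite !modz1.
  rewrite /g; case: egcdzP => a b + _ /=; rewrite (eqP (co n)) => <-.
  by rewrite addrC modzMDl.
have gP n : (g n = g n.+1 %[mod (p ^ n)%N])%Z.
  have g1S : (g n.+1 * residue x n = 1 %[mod (p ^ n)%N])%Z.
    rewrite residueS modzMmr -(modz_pXl _ (leqnSn n)) g1.
    by rewrite (modz_pXl _ (leqnSn n)).
  rewrite -[g n]mulr1 -modzMmr -g1S modzMmr mulrCA -modzMmr g1 modzMmr.
  by rewrite mulr1.
exists (reduce gP); apply: padic_int_eq => n.
by rewrite residueM /= modzMml g1.
Qed.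

Lemma padic_factor (x : Zp) : x != 0 ->
  exists k y z, x = p%:R ^+ k * y /\ z * y = 1.
Proof.
move=> /padic_neq0 ex_n; case: (ex_minnP ex_n) => -[|k] xk minx.
  by move: xk; rewrite -residue_mod expn0 modz1 eqxx.
have /padic_dvdP[y xy] : residue x k = 0.
  by apply/eqP/negPn/negP => /minx; rewrite ltnn.
have [|z zy] := @padic_unitE y; last by exists k, y, z.
apply: contraNneq xk => y1.
have /padic_dvdP[w yw] := y1.
by apply/eqP/padic_dvdP; exists w; rewrite xy yw mulrA expr1 -exprSr.
Qed.

End PadicInt.

Notation padic p_pr := {fraction (padic_int p_pr)}.

Section PadicExpansion.
Variables (p : nat) (p_pr : prime p).
Local Notation Qp := (padic p_pr).
Local Notation tofrac := (@FracField.tofrac (padic_int p_pr)).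

(* u \in p^n Z_p, that is v_p(u) >= n. *)
Definition padic_val_ge (u : Qp) (n : int) : Prop :=
  exists z : padic_int p_pr, u = p%:R ^ n * tofrac z.

(* u is the limit of s in the p-adic topology. *)
Definition padic_lim (s : nat -> Qp) (u : Qp) : Prop :=
  forall N : int, exists M : nat, forall m : nat, (M <= m)%N ->
    padic_val_ge (u - s m) N.

(* The partial sum of the c n p^n over - m <= n < m. *)
Definition padic_psum (c : int -> nat) (m : nat) : Qp :=
  \sum_(i < m.*2) (c (i%:Z - m%:Z))%:R * p%:R ^ (i%:Z - m%:Z).

(* The second clause reads: c n = 0 for n < v_p(u). *)
Definition padic_expansion (u : Qp) (c : int -> nat) : Prop :=
  [/\ forall n, (c n < p)%N,
      forall n, padic_val_ge u (n + 1) -> c n = 0%N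
    & padic_lim (padic_psum c) u].

Definition padic_digit (u : Qp) : int -> nat :=
  xget (fun=> 0%N) [set c | padic_expansion u c].

Local Notation Zp := (padic_int p_pr).

Lemma natp_neq0 : p%:R != 0 :> Qp.
Proof.
rewrite -(rmorph_nat tofrac) tofrac_eq0; apply/eqP.
move=> /(congr1 (fun x : Zp => residue x 2)).
rewrite residue_nat residue0 modz_small; last first.
  by rewrite lez_nat leq0n ltz_nat -{1}(expn1 p) ltn_exp2l ?prime_gt1.
by apply/eqP; rewrite eqz_nat -lt0n prime_gt0.
Qed.

Lemma padic_scale (u : Qp) : exists (k : nat) (z : Zp), u = p%:R ^- k * tofrac z.
Proof.
have [a [b [b0 ->]]] : exists a b : Zp, b != 0 /\ u = tofrac a / tofrac b.
  exists (\n_(repr u)), (\d_(repr u)); split; first exact: denom_ratioP.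
  apply/(canRL (mulfK _)); first by rewrite tofrac_eq0 denom_ratioP.
  rewrite -[X in X * _](reprK u); unlock FracField.tofrac.
  rewrite -[LHS]FracField.pi_mul; apply/eqmodP => /=.
  rewrite FracField.equivfE /FracField.mulf !numden_Ratio ?oner_eq0 //.
    by rewrite !mulr1 mulrC.
  1-2: by rewrite mulr1 denom_ratioP.
have [k [y [z [bE zy]]]] := padic_factor b0; rewrite bE.
exists k, (z * a); rewrite !rmorphM rmorphXn /= rmorph_nat.
have y0 : tofrac y != 0.
  by rewrite tofrac_eq0; apply: contra_eq_neq zy => ->; rewrite mulr0 eq_sym oner_eq0.
have -> : tofrac z = (tofrac y)^-1.
  by apply: (mulIf y0); rewrite mulVf // -rmorphM zy rmorph1.
by rewrite invfM; ring.
Qed.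

Definition nat_psum (e : nat -> nat) (m : nat) := (\sum_(i < m) e i * p ^ i)%N.

Lemma padic_psumE (c : int -> nat) k m : (k <= m)%N ->
  (forall n : int, n < - k%:Z -> c n = 0%N) ->
  padic_psum c m =
  p%:R ^- k * (nat_psum (fun i => c (i%:Z - k%:Z)) (m + k))%:R.
Proof.
move=> km c0.
have -> : padic_psum c m = \sum_(0 <= i < (m - k) + (m + k))
    (c (i%:Z - m%:Z))%:R * p%:R ^ (i%:Z - m%:Z).
  by rewrite big_mkord addnCA subnK // addnn.
rewrite (big_cat_nat (n := m - k)) ?leq_addr //= big_nat big1 ?add0r; last first.
  by move=> i ik; rewrite c0 ?mul0r //; lia.
rewrite -{1}[(m - k)%N]add0n big_addn addKn.
rewrite big_mkord natr_sum mulr_sumr; apply: eq_bigr => i _.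
have -> : (i + (m - k))%N%:Z - m%:Z = i%:Z - k%:Z by lia.
rewrite natrM natrX mulrCA; congr (_ * _).
by rewrite expfzDr ?natp_neq0 // mulrC -exprnP -exprnN.
Qed.

Lemma nat_psum_lt e m : (forall i, e i < p)%N -> (nat_psum e m < p ^ m)%N.
Proof.
move=> ep; elim: m => [|m IHm]; first by rewrite /nat_psum big_ord0.
rewrite /nat_psum big_ord_recr /= -/(nat_psum e m) expnS.
have := leq_mul (ep m) (leqnn (p ^ m)); rewrite mulSn; lia.
Qed.

Lemma nat_psum_mod e m n : (m <= n)%N -> nat_psum e n = nat_psum e m %[mod p ^ m].
Proof.
move=> mn; rewrite -(subnK mn); elim: (n - m)%N => [//|d IHd].
rewrite addSn /nat_psum big_ord_recr /= -/(nat_psum _ _) -modnDm IHd.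
by rewrite expnD mulnA modnMl addn0 modn_mod.
Qed.

Lemma padic_expansion_nat (k : nat) (z : Zp) (c : int -> nat) :
  padic_expansion (p%:R ^- k * tofrac z) c ->
  forall N, residue z N = (nat_psum (fun i => c (i%:Z - k%:Z)) N)%:Z.
Proof.
move=> [cp c0 cvg] N.
have {}c0 (n : int) : n < - k%:Z -> c n = 0%N.
  move=> nk; apply: c0; exists (p%:R ^+ absz (- k%:Z - (n + 1))%R * z).
  rewrite rmorphM rmorphXn rmorph_nat mulrA; congr (_ * _).
  by rewrite exprnN exprnP -expfzDr ?natp_neq0 //; congr (_ ^ _); lia.
have [M /(_ (maxn M (maxn k N)))] := cvg (N%:Z - k%:Z).
rewrite leq_maxl => /(_ isT)[w]; set m := maxn _ _ => uw.
have km : (k <= m)%N by rewrite /m; lia.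
have Nm : (N <= m + k)%N by rewrite /m; lia.
rewrite (padic_psumE km) // in uw.
set S := nat_psum _ _ in uw.
have zS : z - S%:R = p%:R ^+ N * w.
  apply/eqP; rewrite -tofrac_eq rmorphB rmorphM rmorphXn !rmorph_nat; apply/eqP.
  apply: (@mulfI _ (p%:R ^- k)); first by rewrite invr_eq0 expf_neq0 ?natp_neq0.
  rewrite mulrBr uw mulrA; congr (_ * _).
  by rewrite expfzDr ?natp_neq0 // mulrC -exprnP -exprnN.
have -> : z = S%:R + p%:R ^+ N * w by rewrite -zS addrC subrK.
have /padic_dvdP pN : exists w', p%:R ^+ N * w = p%:R ^+ N * w' by exists w.
rewrite residueD pN addr0 residue_nat modz_mod modz_nat.
by rewrite (nat_psum_mod _ Nm) modn_small ?nat_psum_lt.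
Qed.

Lemma padic_expansion_uniq (u : Qp) c c' :
  padic_expansion u c -> padic_expansion u c' -> c = c'.
Proof.
have [k [z ->]] := padic_scale u => cu cu'; apply/funext => n.
wlog nk : k z cu cu' / - k%:Z <= n.
  move=> W; have [kn|nk] := leP (- k%:Z) n; first exact: (W k z).
  have E : p%:R ^- k * tofrac z =
           p%:R ^- `|n|%N * tofrac (p%:R ^+ (`|n|%N - k) * z).
    rewrite rmorphM rmorphXn rmorph_nat mulrA; congr (_ * _).
    by rewrite !exprnN exprnP -expfzDr ?natp_neq0 //; congr (_ ^ _); lia.
  by rewrite E in cu cu'; apply: (W _ _ cu cu'); lia.
have [i ->] : exists i : nat, n = i%:Z - k%:Z by exists (absz (n + k%:Z)); lia.
have eqN N := etrans (esym (padic_expansion_nat cu N)) (padic_expansion_nat cu' N).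
have := eqN i.+1; have := eqN i.
rewrite /nat_psum !big_ord_recr /= => -[->] [] /addnI/eqP.
by rewrite eqn_pmul2r ?expn_gt0 ?prime_gt0 // => /eqP.
Qed.

Lemma padic_expansion_ex (u : Qp) : exists c, padic_expansion u c.
Proof.
have [k [z ->]] := padic_scale u.
pose e i := `|(residue z i.+1 %/ (p ^ i)%N)%Z|%N.
have eE i : (e i)%:Z = (residue z i.+1 %/ (p ^ i)%N)%Z.
  by rewrite gez0_abs // divz_ge0 ?ltz_nat ?expn_gt0 ?prime_gt0 ?residue_ge0.
have zS N : residue z N = (nat_psum e N)%:Z.
  elim: N => [|N IHN]; first by rewrite -residue_mod expn0 modz1 /nat_psum big_ord0.
  rewrite /nat_psum big_ord_recr /= -/(nat_psum e N) PoszD PoszM eE -IHN.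
  by rewrite (residueS z N) addrC -divz_eq.
have ep i : (e i < p)%N.
  rewrite -ltz_nat eE ltz_divLR ?ltz_nat ?expn_gt0 ?prime_gt0 //.
  by rewrite -PoszM -expnS -residue_mod ltz_pmod // ltz_nat expn_gt0 prime_gt0.
pose c (n : int) := if 0 <= n + k%:Z then e (absz (n + k%:Z)) else 0%N.
have ck : (fun i : nat => c (i%:Z - k%:Z)) = e.
  by apply/funext => i; rewrite /c subrK lez_nat leq0n absz_nat.
exists c; split=> [n|n [w zw]|N].
- by rewrite /c; case: ifP => // _; rewrite prime_gt0.
- rewrite /c; case: ifP => // nk.
  have [i ni] : exists i : nat, n + k%:Z = i%:Z by exists (absz (n + k%:Z)); lia.
  rewrite ni absz_nat.
  have /padic_dvdP zi : exists w', z = p%:R ^+ i.+1 * w'.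
    exists w; apply/eqP; rewrite -tofrac_eq rmorphM rmorphXn rmorph_nat; apply/eqP.
    apply: (@mulfI _ (p%:R ^- k)); first by rewrite invr_eq0 expf_neq0 ?natp_neq0.
    rewrite zw mulrA; congr (_ * _).
    by rewrite exprnN exprnP -expfzDr ?natp_neq0 //; congr (_ ^ _); lia.
  by apply/eqP; rewrite -eqz_nat eE zi div0z.
exists (maxn k (absz N)) => m km.
rewrite (@padic_psumE c k) ?ck; [|by lia|]; last first.
  by move=> n nk; rewrite /c ifF //; apply/negbTE; lia.
have /padic_dvdP[w zw] : residue (z - (nat_psum e (m + k))%:R) (m + k) = 0.
  by rewrite residueD residueN residue_nat modzNm modzDmr -zS subrr mod0z.
exists (p%:R ^+ absz (m%:Z - N)%R * w).
have E : tofrac z - (nat_psum e (m + k))%:R = p%:R ^+ (m + k) * tofrac w.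
  by rewrite -(rmorph_nat tofrac p) -rmorphXn -rmorphM -zw rmorphB rmorph_nat.
rewrite -mulrBr E rmorphM rmorphXn rmorph_nat.
rewrite !mulrA; congr (_ * _).
by rewrite exprnN !exprnP -!expfzDr ?natp_neq0 //; congr (_ ^ _); lia.
Qed.

Lemma padic_digitP (u : Qp) : padic_expansion u (padic_digit u).
Proof. exact: (xgetPex _ (padic_expansion_ex u)). Qed.

Lemma padic_digit_finite (u : Qp) :
  finite_set [set n : int | n <= 0 /\ padic_digit u n <> 0%N].
Proof.
have [k [z uz]] := padic_scale u; have [_ u0 _] := padic_digitP u.
apply: (@sub_finite_set _ _ [set - (i%:Z) | i in `I_k.+1]); last first.
  exact/finite_image/finite_II.
move=> n /= [n0 un]; exists `|n|%N; last by lia.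
rewrite /= ltnS leqNgt; apply/negP => kn; apply: un; apply: u0.
exists (p%:R ^+ absz (- k%:Z - (n + 1))%R * z).
rewrite uz rmorphM rmorphXn rmorph_nat mulrA; congr (_ * _).
by rewrite exprnN exprnP -expfzDr ?natp_neq0 //; congr (_ ^ _); lia.
Qed.

Definition padic_floor (u : Qp) : rat :=
  \sum_(n \in [set n : int | n <= 0]) ((padic_digit u n)%:R * p%:R ^ n : rat).

End PadicExpansion.

Section Algorithm.
Variables (R : realType) (p : nat) (p_pr : prime p) (K : fieldType).
Variables (sigma_inf : {rmorphism K -> R}).
Variables (sigma_p : {rmorphism K -> padic p_pr}).

Definition minimizer (d : nat) (t : R) (i : int) : Prop :=
  forall j : int, `|t - i%:~R * d%:R| <= `|t - j%:~R * d%:R|.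

Definition least_minimizer (d : nat) (t : R) : int :=
  xget 0 [set m | minimizer d t m /\ forall i, minimizer d t i -> m <= i].

Lemma least_minimizerP (d : nat) (t : R) : (0 < d)%N ->
  minimizer d t (least_minimizer d t) /\
  forall i, minimizer d t i -> least_minimizer d t <= i.
Proof.
move=> d0; rewrite /least_minimizer.
apply: (xgetPex 0 (P := [set m | minimizer d t m /\ _])).
have d0R : 0 < d%:R :> R by rewrite ltr0n.
pose s := t / d%:R.
have mE i : minimizer d t i <-> forall j : int, `|s - i%:~R| <= `|s - j%:~R|.
  have E (i' : int) : `|t - i'%:~R * d%:R| = `|s - i'%:~R| * d%:R.
    rewrite -{2}(gtr0_norm d0R) -normrM mulrBl /s divfK //.
    by rewrite gt_eqF.
  by split=> H j; move: (H j); rewrite !E ler_pM2r.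
pose m := Num.ceil (s - 2^-1).
have [ml mu] : m%:~R - 1 < s - 2^-1 /\ s - 2^-1 <= m%:~R.
  by split; [rewrite -[1]/(1%:~R) -intrB; apply: ceilB1_lt | apply: ceil_ge].
have far (j : int) : j < m -> `|s - m%:~R| < `|s - j%:~R|.
  move=> jm; have jm' : j%:~R + 1 <= m%:~R :> R.
    by rewrite -[1]/(1%:~R) -intrD ler_int lezD1.
  rewrite [ltRHS]ger0_norm; last by lra.
  by rewrite ltr_norml; apply/andP; split; lra.
exists m; split=> [|i /mE iP].
  apply/mE => j; have [/far/ltW//|mj] := ltP j m.
  have [->//|mj'] := eqVneq j m.
  have jm' : m%:~R + 1 <= j%:~R :> R.
    by rewrite -[1]/(1%:~R) -intrD ler_int lezD1 lt_neqAle eq_sym mj' mj.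
  rewrite [leRHS]ler0_norm; last by lra.
  by rewrite ler_norml; apply/andP; split; lra.
by rewrite leNgt; apply/negP => /far; rewrite ltNge iP.
Qed.

(* [false] and [true] stand for the exponents 0 and 1 of b and F. *)
Definition spacing (eps : bool) : nat := if eps then 1 else p.

Definition partial_quot (eps : bool) (alpha : K) : rat :=
  let r := padic_floor (sigma_p alpha) in
  let d := spacing eps in
  (least_minimizer d (sigma_inf alpha - ratr r))%:~R * d%:R + r.

(* [None] stands for an undefined value. *)
Definition cf_map (eps : bool) (alpha : K) : option K :=
  if alpha == ratr (partial_quot eps alpha) then None
  else Some (alpha - ratr (partial_quot eps alpha))^-1.

Fixpoint cf_seq (alpha : K) (n : nat) : option K :=
  if n is n'.+1 then obind (cf_map (odd n')) (cf_seq alpha n') else Some alpha.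

End Algorithm.

(* Main.v *)
(* Write alpha = A / (p^s B) with B > 0 prime to p.  The p-adic condition on the
   partial quotient b cancels p^s, and more: alpha - b = d N / B with N an
   integer and d = p or 1 the spacing of the step.  The real condition
   |alpha - b| <= d / 2 then says 2 |N| <= B.  If N <> 0, the next term is
   B / (d N), and since d is a power of p, the part of its denominator prime to
   p is at most |N| <= B / 2.  So this positive integer decreases at every step,
   whichever of the two maps is used. *)
Require Import Defs.
From mathcomp Require Import all_boot all_order all_algebra.
From mathcomp Require Import classical_sets functions fsbigop reals.
From mathcomp Require Import zify ring lra.

Set Implicit Arguments.
Unset Strict Implicit.
Unset Printing Implicit Defensive.

Import Order.TTheory GRing.Theory Num.Theory.

Local Open Scope ring_scope.

(* Needed because the library makes [ratr] a morphism only into a numFieldType. *)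
Lemma ratr_fracz (F : fieldType) (a b : int) :
  (forall m : int, m%:~R = 0 :> F -> m = 0) -> b != 0 ->
  ratr (a%:~R / b%:~R) = a%:~R / b%:~R :> F.
Proof.
move=> F0 b0; set x : rat := _ / _.
have xE : numq x * b = a * denq x.
  apply: (@intr_inj rat); rewrite !intrM numqE /x.
  by field; rewrite intr_eq0.
have bF : b%:~R != 0 :> F by apply: contra_neq b0 => /F0.
have dF : (denq x)%:~R != 0 :> F.
  by apply: contra_neq (denq_neq0 x) => /F0.
by rewrite /ratr; apply/eqP; rewrite eqr_div // -!intrM xE.
Qed.

(** Dividing by p^k shifts the digits by k places. The floor keeps the digit of p^0 as well, so it
    retains the first k + 1 digits of [z], whence the residue at [k.+1]. *)
Lemma padic_floor_residue (p : nat) (p_pr : prime p) (k : nat)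
    (z : padic_int p_pr) :
  padic_floor (p%:R ^- k * FracField.tofrac z) =
  (residue z k.+1)%:~R / p%:R ^+ k.
Proof.
set u := _ * _; have cu := padic_digitP u.
have p0 : p%:R != 0 :> rat by rewrite pnatr_eq0 -lt0n prime_gt0.
have small (n : int) : n < - k%:Z -> padic_digit u n = 0%N.
  have [_ c0 _] := cu; move=> nk; apply: c0.
  exists (p%:R ^+ absz (- k%:Z - (n + 1))%R * z).
  rewrite rmorphM rmorphXn rmorph_nat mulrA; congr (_ * _).
  by rewrite exprnN exprnP -expfzDr ?natp_neq0 //; congr (_ ^ _); lia.
rewrite (padic_expansion_nat cu) /padic_floor /nat_psum.
(* Place in [u] of the i-th digit of [z]; the support of the floor lies in the image of 0, ...,
   k. *)
pose h (i : nat) : int := i%:Z - k%:Z.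
have hI : set_inj `I_k.+1 h by move=> i j _ _; rewrite /h; lia.
rewrite -(@fsbig_widen _ _ _ _ (h @` `I_k.+1)%classic); first last.
- move=> n /= [n0 nh]; rewrite small ?mul0r //.
  rewrite ltNge; apply/negP => kn; apply: nh.
  by exists (absz (n + k%:Z)); rewrite /= /h; lia.
- by move=> n /= [i ik <-]; rewrite /h; lia.
rewrite fsbig_image // -fsbig_ord -pmulrn natr_sum mulr_suml.
apply: eq_bigr => i _; rewrite natrM natrX -mulrA; congr (_ * _).
by rewrite /h expfzDr // -exprnP exprnN.
Qed.

Lemma residue_int (p : nat) (p_pr : prime p) (a : int) (n : nat) :
  residue (a%:~R : padic_int p_pr) n = (a %% (p ^ n)%N)%Z.
Proof.
case: a => k; first by rewrite -pmulrn residue_nat.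
by rewrite NegzE mulrNz -pmulrn residueN residue_nat modzNm.
Qed.

(** [B] is a unit of Z_p, so [S] can be A / B reduced mod p^(s+1). The exponent s + 1 instead of s
    leaves a spare factor p, which the step of spacing p needs. *)
Lemma padic_floor_frac (p : nat) (p_pr : prime p) (A : int) (s B : nat) :
  coprime p B ->
  exists S t : int,
    padic_floor (A%:~R / (p ^ s * B)%:R : padic p_pr) = S%:~R / p%:R ^+ s /\
    A = B%:Z * S + (p ^ s.+1)%N%:Z * t.
Proof.
move=> pB; have B1 : residue (B%:R : padic_int p_pr) 1 != 0.
  rewrite residue_nat expn1; apply/eqP => /dvdz_mod0P; rewrite dvdzE !absz_nat.
  by apply/negP; rewrite -prime_coprime.
have [y yB] := padic_unitE B1; set z := A%:~R * y.
have zB : z * B%:R = A%:~R by rewrite -mulrA yB mulr1.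
have B0 : B%:R != 0 :> padic p_pr.
  rewrite -(rmorph_nat (@FracField.tofrac _)) tofrac_eq0.
  by apply: contra_neq B1 => ->; rewrite residue0.
exists (residue z s.+1).
have /dvdzP[t tE] : ((p ^ s.+1)%N %| A - B%:Z * residue z s.+1)%Z.
  rewrite -eqz_mod_dvd -residue_int -zB residueM residue_nat modzMmr.
  by rewrite mulrC.
exists t; split; last by rewrite mulrC [_ * t]mulrC -tE addrC mulrC subrK.
rewrite -padic_floor_residue; congr padic_floor.
rewrite natrM natrX invfM mulrCA; congr (_ * _).
apply: (canLR (mulfK B0)); rewrite -(rmorph_nat (@FracField.tofrac _)).
by rewrite -rmorphM zB rmorph_int.
Qed.

(** Comparing with one neighbour of [i], chosen by the sign of the error, is enough. *)
Lemma minimizer_le_half (R : realType) (d : nat) (t : R) (i : int) :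
  (0 < d)%N -> minimizer d t i -> `|t - i%:~R * d%:R| *+ 2 <= d%:R.
Proof.
move=> d0 iP; have := iP (i + 1); have := iP (i - 1).
rewrite -[`|_| *+ 2]mulr_natl; set x := t - _; set e := d%:R.
have -> : t - (i - 1)%:~R * e = x + e by rewrite /x intrB; ring.
have -> : t - (i + 1)%:~R * e = x - e by rewrite /x intrD; ring.
have e0 : 0 < e by rewrite ltr0n.
move: x e e0 => x e e0; have [x0|x0] := leP 0 x.
  by rewrite (ger0_norm x0) => _; rewrite ler_normr => /orP[]; lra.
by rewrite (ltr0_norm x0) ler_normr => /orP[] + _; lra.
Qed.

Lemma partial_quot_frac (R : realType) (p : nat) (p_pr : prime p)
    (K : fieldType) (sigma_inf : {rmorphism K -> R})
    (sigma_p : {rmorphism K -> padic p_pr}) (eps : bool) (A : int)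
    (s B : nat) (alpha := A%:~R / (p ^ s * B)%:R : K) :
  coprime p B -> (0 < B)%N ->
  exists N : int, (`|N|.*2 <= B)%N /\
    alpha - ratr (partial_quot sigma_inf sigma_p eps alpha) =
    ((spacing p eps)%:Z * N)%:~R / B%:R.
Proof.
move=> pB B0; have p_gt0 := prime_gt0 p_pr.
(* The embedding into the reals forces characteristic 0. *)
have K0 (m : int) : m%:~R = 0 :> K -> m = 0.
  by move=> /(congr1 sigma_inf)/eqP; rewrite rmorph_int rmorph0 intr_eq0 => /eqP.
have d0 : (0 < spacing p eps)%N by rewrite /spacing; case: eps.
have [S [t [floorE AE]]] := padic_floor_frac p_pr A s pB.
rewrite /partial_quot /alpha !fmorph_div !rmorph_int !rmorph_nat floorE.
set T := (X in least_minimizer _ X); set m := least_minimizer _ _.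
have [min_m _] := least_minimizerP T d0; rewrite -/m in min_m.
set d := spacing p eps in d0 m min_m *.
have [c pd] : exists c : nat, p = (d * c)%N.
  by rewrite /d /spacing; case: (eps); [exists p | exists 1%N]; lia.
(* Subtracting the floor S / p^s from alpha leaves p t / B = d c t / B; subtracting m d as well
   leaves d N / B. *)
pose N := c%:Z * t - m * B%:Z.
have AE' : A = B%:Z * S + (p ^ s)%N%:Z * d%:Z * c%:Z * t.
  by rewrite {1}AE expnSr {2}pd !PoszM; ring.
have pR : p%:R != 0 :> R by rewrite pnatr_eq0 -lt0n.
have BR : B%:R != 0 :> R by rewrite pnatr_eq0 -lt0n.
have TE : T - m%:~R * d%:R = N%:~R / B%:R * d%:R.
  rewrite /T fmorph_div rmorph_int rmorphXn /= ratr_nat /N AE'.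
  rewrite !(intrM, intrD, intrB, =^~ pmulrn) natrM natrX.
  by field; rewrite BR expf_neq0.
exists N; split.
  have := minimizer_le_half d0 min_m; rewrite TE normrM (ger0_norm (ler0n R d)).
  rewrite -mulrnAl -[leRHS]mul1r ler_pM2r ?ltr0n // normrM normfV.
  rewrite (ger0_norm (ler0n R B)) -mulrnAl ler_pdivrMr ?ltr0n // mul1r.
  by rewrite -intr_norm -pmulrn -mulrnA muln2 ler_nat.
have pX0 : (p ^ s)%N != 0%N by rewrite -lt0n expn_gt0 p_gt0.
(* A single quotient of integers, the form in which [ratr_fracz] evaluates [ratr] in [K]. *)
have -> : m%:~R * d%:R + S%:~R / p%:R ^+ s =
    (m * d%:Z * (p ^ s)%N%:Z + S)%:~R / (p ^ s)%N%:Z%:~R :> rat.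
  rewrite !(intrM, intrD, =^~ pmulrn) natrX.
  by field; rewrite expf_neq0 // pnatr_eq0 -lt0n.
rewrite ratr_fracz //.
have BK : B%:R != 0 :> K.
  by apply/eqP; rewrite pmulrn => /K0 /eqP; rewrite eqz_nat -leqn0 leqNgt B0.
have pXK : (p ^ s)%:R != 0 :> K.
  by apply/eqP; rewrite pmulrn => /K0 /eqP; rewrite eqz_nat (negPf pX0).
rewrite /N AE' !(intrM, intrD, intrB, =^~ pmulrn) natrM.
by field; rewrite BK pXK.
Qed.

Lemma cf_map_frac (R : realType) (p : nat) (p_pr : prime p)
    (K : fieldType) (sigma_inf : {rmorphism K -> R})
    (sigma_p : {rmorphism K -> padic p_pr}) (eps : bool) (A : int)
    (s B : nat) (alpha beta : K) :
  coprime p B -> (0 < B)%N -> alpha = A%:~R / (p ^ s * B)%:R ->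
  cf_map sigma_inf sigma_p eps alpha = Some beta ->
  exists (A' : int) (s' B' : nat),
    [/\ coprime p B', (0 < B' < B)%N & beta = A'%:~R / (p ^ s' * B')%:R].
Proof.
move=> pB B0 alphaE; rewrite /cf_map; case: eqP => // /eqP alpha_b [<-].
have [N [NB bE]] := partial_quot_frac sigma_inf sigma_p eps A s pB B0.
rewrite -alphaE in bE; rewrite -subr_eq0 bE in alpha_b; rewrite bE.
have N0 : (0 < `|N|)%N.
  by rewrite absz_gt0; apply: contra_neq alpha_b => ->; rewrite mulr0 mul0r.
have [B' pB' NE] := pfactor_coprime p_pr N0.
have [e dE] : exists e, spacing p eps = (p ^ e)%N.
  by case: (eps); [exists 0%N | exists 1%N].
(* In B / (d N), the sign of N moves to the numerator, and its p-part joins d in the power of p. *)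
exists (sgz N * B%:Z), (e + logn p `|N|)%N, B'; split=> //.
  have B'0 : (0 < B')%N by move: N0; rewrite NE muln_gt0 => /andP[].
  have : (B' <= `|N|)%N.
    by rewrite NE leq_pmulr // expn_gt0 prime_gt0.
  by lia.
have -> : (p ^ (e + logn p `|N|) * B')%N = (spacing p eps * `|N|)%N.
  by rewrite dE expnD -mulnA [(_ * B')%N]mulnC -NE.
rewrite {1}[N]intEsg mulrCA !intrM -!pmulrn natrM !invfM invrK.
(* This includes the value 0, whose inverse is 0 by convention. *)
have sgV : (sgz N)%:~R^-1 = (sgz N)%:~R :> K.
  by case: sgzP => _; rewrite ?mulr0z ?mulr1z ?mulrN1z ?invrN ?invr0 ?invr1.
by rewrite sgV; ring.
Qed.

(** Strong induction on [B]. The index [n] is arbitrary so that the induction can resume at either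
    parity; fractions need not be reduced. *)
Lemma cf_seq_frac_halts (R : realType) (p : nat) (p_pr : prime p)
    (K : fieldType) (sigma_inf : {rmorphism K -> R})
    (sigma_p : {rmorphism K -> padic p_pr}) (alpha0 : K) (n : nat) (A : int)
    (s B : nat) :
  coprime p B -> (0 < B)%N ->
  cf_seq sigma_inf sigma_p alpha0 n = Some (A%:~R / (p ^ s * B)%:R) ->
  exists n', cf_seq sigma_inf sigma_p alpha0 n' = None.
Proof.
elim/ltn_ind: B n A s => B IH n A s pB B0 En.
case Emap : (cf_map sigma_inf sigma_p (odd n) (A%:~R / (p ^ s * B)%:R))
  => [beta|]; last by exists n.+1; rewrite /= En.
have [A' [s' [B' [pB' /andP[B'0 B'B] betaE]]]] :=
  cf_map_frac pB B0 erefl Emap.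
by apply: (IH _ B'B n.+1 A' s' pB' B'0); rewrite /= En /= Emap betaE.
Qed.

Theorem theorem2p5 (R : realType) (p : nat) (p_pr : prime p) (K : fieldType)
    (sigma_inf : {rmorphism K -> R}) (sigma_p : {rmorphism K -> padic p_pr})
    (q : rat) :
  exists n : nat, cf_seq sigma_inf sigma_p (ratr q) n = None.
Proof.
have den_gt0 : (0 < `|denq q|)%N by rewrite absz_gt0 denq_neq0.
have [B pB denE] := pfactor_coprime p_pr den_gt0.
have B0 : (0 < B)%N by move: den_gt0; rewrite denE muln_gt0 => /andP[].
apply: (@cf_seq_frac_halts _ _ _ _ _ _ _ 0 (numq q) (logn p `|denq q|) B) => //.
by rewrite mulnC -denE /= /ratr pmulrn absz_denq.
Qed.
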